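(* Let $\{X_1,\dots,X_n\}$ be a sample of a positive random variable $X$ that has an infinite mean. Let $u:\mathcal J=[0,\infty)\to u(\mathcal J)\subset[0,\infty)$ be a continuous, (strictly) monotone decreasing function such that $E[u^2(X)]<\infty$, and let $v=u^{-1}$. Suppose that a number $q_\alpha$ has been determined such that in the transformed variables $$P\left(\left|\frac{\frac1n\sum_{k=1}^n u(X_k)-E[u(X)]}{\hat\sigma(u(X))}\right|>q_\alpha\right)\le 1-\alpha .\qquad( * )$$ With $A=\inf u(\mathcal J)$, $B=\sup u(\mathcal J)$, put $$l_\alpha(n)=\max\big(A,\ \overline X_u(n)-q_\alpha\hat\sigma(u(X))\big),\qquad u_\alpha(n)=\min\big(B,\ \overline X_u(n)+q_\alpha\hat\sigma(u(X))\big).$$ Then the interval $\big(l_\alpha(n),u_\alpha(n)\big)$ is transformed back to the original coordinates as $$L_\alpha(n)=v\big(u_\alpha(n)\big),\qquad U_\alpha(n)=v\big(\overline X_u(n)-q_\alpha\hat\sigma(u(X))\big),$$ and $( * )$ becomes $$P\big(E_u[X]\in[L_\alpha(n),U_\alpha(n)]\big)\le 1-\alpha .$$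
   Context: $E_u[X]=u^{-1}\big(E[u(X)]\big)$ is the $u$-mean of $X$. Its sample estimator is $\overline X_u(n)=u^{-1}\big(\frac1n\sum_{k=1}^n u(X_k)\big)$, and $\hat\sigma(u(X))$ is the square root of the estimator of the variance of $u(X)$ given by $\hat\sigma^2(u(X))=\frac1{n-1}\sum_{k=1}^n\big(u(X_k)-u(\overline X_u(n))\big)^2$, where $u(\overline X_u(n))=\frac1n\sum_{k=1}^n u(X_k)$.
   Formalization: The final display is corrected to P(E_u[X] not in [L,U]) ≤ 1−α (as printed it fails for large q); l, u and U are centred at u(X̄_u(n)), the mean of the u(X_k), instead of X̄_u(n); v is set to +∞ at and below A, where it is undefined. *)

(* Defs.v *)
From mathcomp Require Export all_boot all_order all_algebra.
From mathcomp Require Export all_classical all_reals all_analysis.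
Export Order.TTheory GRing.Theory Num.Theory.
Export numFieldNormedType.Exports.

Set Implicit Arguments.
Unset Strict Implicit.
Unset Printing Implicit Defensive.

Local Open Scope classical_set_scope.
Local Open Scope ring_scope.

Section sample.
Context d (T : measurableType d) (R : realType) (P : probability T R) (n : nat).

Definition mutually_independent (Xs : 'I_n -> {RV P >-> R}) : Prop :=
  forall (K : {set 'I_n}) (S : 'I_n -> set R),
    (forall k, k \in K -> measurable (S k)) ->
    P [set w | forall k, k \in K -> S k (Xs k w)] =
    (\prod_(k in K) P (Xs k @^-1` S k))%E.

Definition is_sample (X : {RV P >-> R}) (Xs : 'I_n -> {RV P >-> R}) : Prop :=
  mutually_independent Xs /\
  forall k (S : set R), measurable S ->
    distribution P (Xs k) S = distribution P X S.

End sample.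

Section transform.
Context (R : realType) (u : R -> R).

Definition range_inf : R := inf (u @` `[0, +oo[).
Definition range_sup : R := sup (u @` `[0, +oo[).

(* Outside the image of [u] the value is the default 0. *)
Definition uinv : R -> R := 'pinv_(fun=> 0) `[0, +oo[ u.

(* For a continuous decreasing [u], the image of [0, +oo[ is ]A, B] with A not
   attained, so the back-transform of a lower bound clamped at A is the limit
   +oo of [uinv] at A.  Lower bounds below A receive the same value, hence
   [uinv_ext y] and [uinv_ext (Num.max A y)] agree. *)
Definition uinv_ext (y : R) : \bar R :=
  if y <= range_inf then +oo%E else (uinv y)%:E.

Context d (T : measurableType d) (P : probability T R).

Definition u_mean (X : {RV P >-> R}) : R := uinv (fine 'E_P[u \o X]%E).

Context (n : nat) (Xs : 'I_n -> {RV P >-> R}).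

Definition transformed_mean (w : T) : R := n%:R^-1 * \sum_(k < n) u (Xs k w).

Definition sample_u_mean (w : T) : R := uinv (transformed_mean w).

Definition sample_sd (w : T) : R :=
  Num.sqrt ((n%:R - 1)^-1 *
    \sum_(k < n) (u (Xs k w) - u (sample_u_mean w)) ^+ 2).

(* Extended-real division: when [sample_sd w = 0] the statistic is infinite
   unless its numerator vanishes, in which case it is 0. *)
Definition studentized (X : {RV P >-> R}) (w : T) : \bar R :=
  (((transformed_mean w)%:E - 'E_P[u \o X]) / (sample_sd w)%:E)%E.

(* The bounds [lower] and [upper] live in the transformed coordinates, so they
   are centred at the image by [u] of the sample u-mean. *)
Definition lower (q : R) (w : T) : R :=
  Num.max range_inf (u (sample_u_mean w) - q * sample_sd w).

Definition upper (q : R) (w : T) : R :=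
  Num.min range_sup (u (sample_u_mean w) + q * sample_sd w).

Definition back_lower (q : R) (w : T) : \bar R := uinv_ext (upper q w).

Definition back_upper (q : R) (w : T) : \bar R :=
  uinv_ext (u (sample_u_mean w) - q * sample_sd w).

End transform.

(* Main.v *)
(* The inverse of the decreasing [u] reverses order on ]A, B], so the
   back-transformed interval contains [u_mean u X] exactly when the transformed
   mean lies within [q * sample_sd] of [E[u(X)]].  For [0 <= q] non-coverage is
   therefore the same event as the studentized statistic exceeding [q].  For
   [q < 0] that last event is the whole space, so the hypothesis already says
   [1 <= 1 - alpha]; only measurability of non-coverage is then needed. *)
Require Import Defs.
From mathcomp Require Import measurable_realfun lra.

Set Implicit Arguments.
Unset Strict Implicit.

Local Open Scope classical_set_scope.
Local Open Scope ring_scope.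

(** Serves levels above [B], reached by [m - e] when [e] is negative, where [uinv] takes its
    default. *)
Lemma pinv_out (aT rT : Type) (dflt : rT -> aT) (D : set aT) (f : aT -> rT) y :
  ~ (f @` D) y -> 'pinv_dflt D f y = dflt y.
Proof.
move=> fDy; rewrite /pinv_ splitV.
(* The partial inverse is by definition a case split on membership in the image. *)
have -> : 'oinv_[fun f in D] y =
    if pselect ((f @` D) y) is left fDy' then Some (projT1 (cid2 fDy')) else None.
  by [].
by case: pselect.
Qed.

(** * Inverse of [u] and transport of intervals through it *)

Section transform.
Variables (R : realType) (u : R -> R).
Hypothesis u_cont : {within `[0, +oo[%classic, continuous u}.
Hypothesis u_decr : {in `[0, +oo[ &, {homo u : x y /~ x < y}}.
Hypothesis u_ge0 : {in `[0, +oo[, forall x, 0 <= u x}.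

Local Notation A := (range_inf u).
Local Notation B := (range_sup u).

Let ltu (x y : R) : 0 <= x -> x < y -> u y < u x.
Proof.
by move=> x0 xy; apply: u_decr => //; rewrite in_itv/= andbT // (le_trans x0)// ltW.
Qed.

Let leu (x y : R) : 0 <= x -> x <= y -> u y <= u x.
Proof.
by move=> x0; rewrite le_eqVlt => /predU1P[->//|xy]; exact/ltW/ltu.
Qed.

Lemma range_inf_ge0 : 0 <= A.
Proof.
apply: lb_le_inf; first by exists (u 0), 0 => //=; rewrite in_itv/= lexx.
by move=> _ [x /= x0 <-]; exact: u_ge0.
Qed.

(** The infimum is not attained: [u (x + 1)] is a value strictly below [u x]. *)
Lemma range_inf_lt (x : R) : 0 <= x -> A < u x.
Proof.
move=> x0; apply: (@le_lt_trans _ _ (u (x + 1))); last first.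
  by apply: ltu => //; rewrite ltrDl.
apply: ge_inf; first by exists 0 => _ [y /= y0 <-]; exact: u_ge0.
by exists (x + 1) => //=; rewrite in_itv/= andbT addr_ge0.
Qed.

Lemma range_supE : B = u 0.
Proof.
apply/eqP; rewrite eq_le; apply/andP; split.
  apply: ge_sup; first by exists (u 0), 0 => //=; rewrite in_itv/= lexx.
  by move=> y [x /=]; rewrite in_itv/= andbT => x0 <-; exact: leu.
apply: ub_le_sup; last by exists 0 => //=; rewrite in_itv/= lexx.
by exists (u 0) => y [x /=]; rewrite in_itv/= andbT => x0 <-; exact: leu.
Qed.

Lemma le_range_sup (x : R) : 0 <= x -> u x <= B.
Proof. by move=> x0; rewrite range_supE; exact: leu. Qed.

(** Since [y] exceeds the infimum, some [u x] lies below it; the intermediate value theorem on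
    [[0, x]] applies because [B = u 0]. *)
Lemma range_uP (y : R) : A < y -> y <= B -> (u @` `[0, +oo[) y.
Proof.
move=> Ay yB; have [_ [x /= x0 <-] uxy] : exists2 z, (u @` `[0, +oo[) z & z < y.
  by apply: inf_lt => //; exists (u 0), 0 => //=; rewrite in_itv/= lexx.
move: x0; rewrite in_itv/= andbT => x0.
have [||c c0x <-] := IVT (f := u) (v := y) x0.
- apply: continuous_subspaceW u_cont => z /=.
  by rewrite !in_itv/= andbT => /andP[].
- by rewrite ge_min le_max -range_supE yB (ltW uxy) orbT.
- exists c => //=; move: c0x; rewrite !in_itv/= andbT => /andP[]//.
Qed.

Lemma uinvK (y : R) : A < y -> y <= B -> u (uinv u y) = y.
Proof. by move=> Ay yB; apply: pinvK; rewrite inE; exact: range_uP. Qed.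

Lemma uinv_ge0 (y : R) : A < y -> y <= B -> 0 <= uinv u y.
Proof.
move=> Ay yB.
suff: `[0, +oo[%classic (uinv u y) by rewrite /= in_itv/= andbT.
by apply: (surjpinv_image_sub (@subset_refl _ _)); exists y => //; exact: range_uP.
Qed.

Lemma uK (x : R) : 0 <= x -> uinv u (u x) = x.
Proof.
move=> x0; apply: pinvKV; last by rewrite inE/= in_itv/= andbT.
move=> a b; rewrite !inE/= !in_itv/= !andbT => a0 b0 uab.
by case: (ltgtP a b) => // [/(ltu a0)|/(ltu b0)]; rewrite uab ltxx.
Qed.

Lemma uinv_lt (y z : R) : A < y <= B -> A < z <= B -> (uinv u y < uinv u z) = (z < y).
Proof.
move=> /andP[Ay yB] /andP[Az zB]; apply/idP/idP => [/ltu|]; last rewrite !ltNge.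
  by rewrite !uinvK//; apply; exact: uinv_ge0.
by apply: contraNN => /leu; rewrite !uinvK//; apply; exact: uinv_ge0.
Qed.

Lemma uinv_le (y z : R) : A < y <= B -> A < z <= B -> (uinv u y <= uinv u z) = (z <= y).
Proof. by move=> Ay Az; rewrite leNgt uinv_lt// -leNgt. Qed.

Lemma uinv_extE (y : R) : A < y -> uinv_ext u y = (uinv u y)%:E.
Proof. by move=> Ay; rewrite /uinv_ext leNgt Ay. Qed.

Lemma uinv_out (y : R) : B < y -> uinv u y = 0.
Proof.
move=> By; apply: pinv_out => -[x /=]; rewrite in_itv/= andbT => x0 uxy.
by move: By; rewrite -uxy ltNge le_range_sup.
Qed.

(** Order reversal turns each back-transformed bound into a bound on [mu]. Clamping at [B] costs
    nothing as [mu <= B]; if [m - e <= A], the upper bound is infinite and [m - e <= mu] holds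
    anyway. *)
Lemma uinv_ext_cover (m e mu : R) : A < m <= B -> 0 <= e -> A < mu <= B ->
  (uinv_ext u (Num.min B (m + e))%R <= (uinv u mu)%:E <= uinv_ext u (m - e)%R)%E
  = (`|m - mu| <= e).
Proof.
move=> /andP[Am mB] e0 /[dup] muAB /andP[Amu muB].
have AU : A < Num.min B (m + e) <= B.
  rewrite ge_min lexx lt_min (lt_le_trans Am mB)/= andbT. lra.
rewrite uinv_extE; last by case/andP: AU.
rewrite lee_fin uinv_le// le_min muB/= ler_norml.
have -> : (- e <= m - mu) = (mu <= m + e) by apply/idP/idP; lra.
congr andb; have -> : (m - mu <= e) = (m - e <= mu) by apply/idP/idP; lra.
have [Ae|Ae] := leP (m - e) A.
  by rewrite /uinv_ext Ae leey; apply/esym; lra.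
rewrite uinv_extE// lee_fin uinv_le// Ae/=; lra.
Qed.

Lemma uinv_ext_reversed (m e : R) : A < m <= B -> e < 0 ->
  (uinv_ext u (m - e)%R < uinv_ext u (Num.min B (m + e))%R)%E.
Proof.
move=> /andP[Am mB] e0; rewrite min_r; last lra.
rewrite (@uinv_extE (m - e)); last lra.
have [Ae|Ae] := leP (m + e) A; first by rewrite /uinv_ext Ae ltry.
rewrite uinv_extE// lte_fin.
have meB : A < m + e <= B by rewrite Ae/=; lra.
have [eB|Be] := leP (m - e) B; first by rewrite uinv_lt//; lra.
(* Above [B] the default 0 keeps the inequality: [0 <= uinv u B], and [m + e < B] gives
   [uinv u B < uinv u (m + e)]. *)
rewrite uinv_out//; apply: (@le_lt_trans _ _ (uinv u B)).
  by apply: uinv_ge0 => //; lra.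
by rewrite uinv_lt//; lra.
Qed.

(** For [e <= 0] both intervals are empty. For [0 < e], order reversal gives one inclusion and
    continuity of [u] enters only through the range of its inverse. *)
Lemma uinv_ext_image (m e : R) : A < m <= B ->
  uinv_ext u @` `]Num.max A (m - e), Num.min B (m + e)[%classic =
  `]uinv_ext u (Num.min B (m + e)), uinv_ext u (m - e)[%classic.
Proof.
move=> /[dup] mAB /andP[Am mB]; have [e0|e0] := leP e 0.
  have -> : `]Num.max A (m - e), Num.min B (m + e)[%classic = set0.
    by apply: set_itv_ge; rewrite bnd_simp -leNgt le_max !ge_min; lra.
  rewrite image_set0 set_itv_ge// bnd_simp -leNgt.
  move: e0; rewrite le_eqVlt => /predU1P[->|/(uinv_ext_reversed mAB)/ltW//].
  by rewrite subr0 addr0 min_r.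
have AU : A < Num.min B (m + e) <= B.
  by rewrite ge_min lexx lt_min (lt_le_trans Am mB)/= andbT; lra.
rewrite (@uinv_extE (Num.min _ _)); last by case/andP: AU.
move: AU; set b := Num.min _ _ => /andP[Ab bB].
apply/seteqP; split => [_ [y /= + <-]|z /=]; rewrite !in_itv/=.
  rewrite gt_max => /andP[/andP[Ay ey] yb].
  have yAB : A < y <= B by rewrite Ay (le_trans (ltW yb)).
  rewrite uinv_extE// lte_fin uinv_lt ?Ab// yb/=.
  have [Ae|Ae] := leP (m - e) A; first by rewrite /uinv_ext Ae ltry.
  by rewrite uinv_extE// lte_fin uinv_lt// Ae/=; lra.
case: z => [r| |]/andP[] //; last by move=> _; rewrite ltNge leey.
rewrite lte_fin => br rU; have r0 : 0 <= r by rewrite (le_trans _ (ltW br))// uinv_ge0.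
(* Infinite points being excluded, [r] is a nonnegative real, so [u r] is its preimage. *)
exists (u r); last by rewrite uinv_extE ?uK// range_inf_lt.
rewrite in_itv/= gt_max range_inf_lt//=; apply/andP; split; last first.
  by rewrite -(uinvK Ab bB) ltu// uinv_ge0.
have [Ae|Ae] := leP (m - e) A; first by rewrite (le_lt_trans Ae)// range_inf_lt.
have eB : m - e <= B by lra.
by move: rU; rewrite uinv_extE// lte_fin => /(ltu r0); rewrite uinvK.
Qed.

End transform.

(** If equality held, the positive function [Y - a] would have integral 0 and vanish almost
    everywhere, which makes the whole space null. *)
Lemma expectation_gt d (T : measurableType d) (R : realType)
    (P : probability T R) (Y : T -> R) (a : R) :
  measurable_fun setT Y -> 0 <= a -> (forall w, a < Y w) -> (a%:E < 'E_P[Y])%E.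
Proof.
move=> mY a0 aY.
pose Z : T -> R := fun w => Y w - a.
have mZ : measurable_fun setT (EFin \o Z).
  by apply/measurable_EFinP; exact: measurable_funB.
have Z0 w : (0 <= (Z w)%:E)%E by rewrite lee_fin subr_ge0 ltW.
have EYE : ('E_P[Y] = a%:E + \int[P]_w (Z w)%:E)%E.
  transitivity (\int[P]_w (a%:E + (Z w)%:E))%E.
    by rewrite unlock; apply: eq_integral => w _; rewrite -EFinD subrKC.
  rewrite ge0_integralD//.
  by rewrite integral_cst//= probability_setT mule1.
have I0 : (0 <= \int[P]_w (Z w)%:E)%E by apply: integral_ge0 => w _; exact: Z0.
rewrite EYE lteDl// lt0e I0 andbT; apply/eqP => I_eq0.
have /(ae_eq_integral_abs P measurableT mZ) [N [mN PN0 subN]] :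
    (\int[P]_(w in setT) `|(EFin \o Z) w| = 0)%E.
  by rewrite -[RHS]I_eq0; apply: eq_integral => w _; rewrite gee0_abs /=.
have N_T : N = setT.
  rewrite -subTset => w _; apply: subN => /= /(_ I) [] /eqP.
  by rewrite subr_eq0 gt_eqF.
by move: PN0 => /=; rewrite N_T probability_setT => /eqP; rewrite onee_eq0.
Qed.

(** * Coverage and the studentized statistic *)

Section coverage.
Variables (d : measure_display) (T : measurableType d) (R : realType).
Variables (P : probability T R) (n : nat) (X : {RV P >-> R}).
Variables (Xs : 'I_n -> {RV P >-> R}) (u : R -> R).
Hypothesis n_gt1 : (1 < n)%N.
Hypothesis X_gt0 : forall w, 0 < X w.
Hypothesis Xs_gt0 : forall k w, 0 < Xs k w.
Hypothesis u_cont : {within `[0, +oo[%classic, continuous u}.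
Hypothesis u_decr : {in `[0, +oo[ &, {homo u : x y /~ x < y}}.
Hypothesis u_ge0 : {in `[0, +oo[, forall x, 0 <= u x}.

Local Notation A := (range_inf u).
Local Notation B := (range_sup u).
Local Notation m := (transformed_mean u Xs).
Local Notation s := (sample_sd u Xs).
Let mu := fine 'E_P[u \o X].

Let measurable_uX : measurable_fun setT (u \o X).
Proof.
(* [u] is continuous only on the half-line, so measurability is taken there; positivity of [X] keeps
   its values inside. *)
apply: (measurable_comp (measurable_itv `[0, +oo[)) => //.
  by move=> _ [w _ <-]; rewrite /= in_itv/= andbT ltW.
exact: subspace_continuous_measurable_fun.
Qed.

(** Places [E[u(X)]] in the image of [u], so that [u_mean] is a true inverse value; the strict bound
    matters because [A] is not attained. *)
Lemma expectation_uX_bounds : (A%:E < 'E_P[u \o X] <= B%:E)%E.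
Proof.
apply/andP; split.
  apply: expectation_gt => //; first exact: range_inf_ge0.
  by move=> w; apply: range_inf_lt => //; exact: ltW.
have -> : (B%:E = 'E_P[cst B])%E by rewrite expectation_cst.
have B_ge w : u (X w) <= B by apply: le_range_sup => //; exact: ltW.
have uX_ge0 w : 0 <= u (X w) by apply: u_ge0; rewrite in_itv/= andbT ltW.
apply: expectation_le => //; last exact: aeW.
by move=> w; exact: le_trans (B_ge w).
Qed.

Lemma expectation_uXE : 'E_P[u \o X]%E = mu%:E.
Proof.
rewrite fineK// fin_numElt; case/andP: expectation_uX_bounds => AE EB.
by rewrite (lt_trans (ltNyr _) AE) (le_lt_trans EB (ltry _)).
Qed.

Lemma mu_bounds : A < mu <= B.
Proof. by move: expectation_uX_bounds; rewrite expectation_uXE. Qed.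

Let n_gt0 : 0 < n%:R :> R. Proof. by rewrite ltr0n ltnW. Qed.

Lemma transformed_mean_bounds w : A < m w <= B.
Proof.
(* Each bound is written as an average of [n] copies of itself, for a termwise comparison;
   strictness needs at least one index. *)
have cE (c : R) : c = n%:R^-1 * \sum_(k < n) c.
  by rewrite sumr_const card_ord -[c *+ n]mulr_natl mulKf// gt_eqF.
rewrite [X in X < _]cE [X in _ <= X]cE /transformed_mean.
rewrite ltr_pM2l ?ler_pM2l ?invr_gt0//; apply/andP; split.
  apply: ltr_sum => [|k _]; last by apply: range_inf_lt => //; exact: ltW.
  by apply/hasP; exists (Ordinal (ltnW n_gt1)) => //; rewrite mem_index_enum.
by apply: ler_sum => k _; apply: le_range_sup => //; exact: ltW.
Qed.

Lemma u_sample_u_mean w : u (sample_u_mean u Xs w) = m w.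
Proof. by case/andP: (transformed_mean_bounds w) => ? ?; exact: uinvK. Qed.

Lemma back_transform_interval q w :
  uinv_ext u @` `]lower u Xs q w, upper u Xs q w[%classic =
  `]back_lower u Xs q w, back_upper u Xs q w[%classic.
Proof.
rewrite /back_lower /back_upper /lower /upper u_sample_u_mean.
exact/uinv_ext_image/transformed_mean_bounds.
Qed.

Local Notation covered q w :=
  (back_lower u Xs q w <= (u_mean u X)%:E <= back_upper u Xs q w)%E.

Lemma coveredE q w : 0 <= q * s w -> covered q w = (`|m w - mu| <= q * s w).
Proof.
move=> qs0; rewrite /back_lower /back_upper /upper u_sample_u_mean.
by apply: uinv_ext_cover => //; [exact: transformed_mean_bounds|exact: mu_bounds].
Qed.

Lemma covered_lt0 q w : q * s w < 0 -> covered q w = false.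
Proof.
move=> qs0; apply/negbTE/negP => /andP[/le_trans/[apply]].
rewrite /back_lower /back_upper /upper u_sample_u_mean.
by rewrite leNgt uinv_ext_reversed// transformed_mean_bounds.
Qed.

Lemma studentized_gt q w : 0 <= q ->
  (q%:E < `|studentized u Xs X w|)%E = ~~ covered q w.
Proof.
move=> q0; rewrite coveredE ?mulr_ge0 ?sqrtr_ge0// -ltNge.
rewrite /studentized expectation_uXE -EFinB.
(* At zero deviation the inverse is [+oo]: the statistic is 0 if [m w = mu] and infinite in absolute
   value otherwise, matching coverage exactly when [m w = mu]. *)
have [s0|s_neq0] := eqVneq (s w) 0.
  rewrite s0 mulr0 inve0; have [->|mmu] := eqVneq (m w - mu) 0.
    by rewrite mul0e abse0 normr0 ltxx lte_fin ltNge q0.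
  by rewrite abseM /= gt0_muley ?ltry ?normr_gt0// lte_fin normr_gt0.
have s_gt0 : 0 < s w by rewrite lt_def s_neq0 sqrtr_ge0.
rewrite inver (negbTE s_neq0) -EFinM abse_EFin lte_fin normrM normfV.
by rewrite (gtr0_norm s_gt0) ltr_pdivlMr.
Qed.

(** As [1 < n], the factor before the sum of squares is positive, so a zero deviation kills every
    square. *)
Lemma sample_sd_eq0 w : s w = 0 <-> forall k, u (Xs k w) = m w.
Proof.
have n1 : 0 < (n%:R - 1)^-1 :> R by rewrite invr_gt0 subr_gt0 ltr1n.
have sq_ge0 (k : 'I_n) : true -> 0 <= (u (Xs k w) - m w) ^+ 2.
  by move=> _; exact: sqr_ge0.
rewrite /sample_sd u_sample_u_mean; split => [/eqP|uE].
  rewrite sqrtr_eq0 pmulr_rle0// => S_le0 k.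
  have /eqP : \sum_(k < n) (u (Xs k w) - m w) ^+ 2 = 0.
    by apply/eqP; rewrite eq_le S_le0 sumr_ge0.
  rewrite psumr_eq0// => /allP /(_ k (mem_index_enum _)).
  by rewrite /= sqrf_eq0 subr_eq0 => /eqP.
by rewrite big1 ?mulr0 ?sqrtr0// => k _; rewrite uE subrr expr0n.
Qed.

(* A negative [q] reverses the bounds as soon as the deviation is nonzero. *)
Lemma covered_neg q : q < 0 ->
  [set w | covered q w] = \bigcap_(k in [set: 'I_n]) (Xs k @^-1` [set uinv u mu]).
Proof.
move=> q0; have [Amu muB] := andP mu_bounds.
apply/seteqP; split => w /=.
  have [s0|s_neq0] := eqVneq (s w) 0; last first.
    by rewrite covered_lt0// nmulr_rlt0// lt_def s_neq0 sqrtr_ge0.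
  (* With zero deviation, coverage forces [m w = mu], and all [u (Xs k w)] equal [m w]; injectivity
     of [u] then fixes each [Xs k w]. *)
  rewrite coveredE s0 mulr0// normr_le0 subr_eq0 => /eqP mE k _ /=.
  by have /sample_sd_eq0 /(_ k) uXk := s0; rewrite -mE -uXk uK// ltW.
move=> XsE.
have uXs k : u (Xs k w) = mu by rewrite (XsE k I) uinvK.
have mE : m w = mu.
  rewrite /transformed_mean (eq_bigr (fun=> mu)) => [|k _]; last exact: uXs.
  by rewrite sumr_const card_ord -[mu *+ n]mulr_natl mulKf// gt_eqF.
have s0 : s w = 0 by apply/sample_sd_eq0 => k; rewrite mE.
by rewrite coveredE s0 mulr0// mE subrr normr0.
Qed.

Lemma noncoverage_le q alpha :
  (P [set w | (q%:E < `|studentized u Xs X w|)%E] <= (1 - alpha)%:E)%E ->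
  (P [set w | ~ covered q w] <= (1 - alpha)%:E)%E.
Proof.
have [q0|q0] := leP 0 q.
  apply: le_trans; rewrite le_eqVlt; apply/orP; left; apply/eqP.
  congr (P _); apply/funext => w; apply/propext => /=.
  by rewrite studentized_gt//; split => /negP.
have -> : [set w | (q%:E < `|studentized u Xs X w|)%E] = setT.
  by rewrite -subTset => w _ /=; rewrite (lt_le_trans _ (abse_ge0 _))// lte_fin.
rewrite probability_setT; apply: le_trans; apply: probability_le1.
(* By [covered_neg], coverage is a finite intersection of preimages of a single point, hence
   measurable. *)
rewrite -[X in measurable X]/(~` [set w | covered q w]).
apply: measurableC; rewrite covered_neg//.
apply: fin_bigcap_measurable => [|k _]; first exact: finite_finset.
by rewrite -[X in measurable X]setTI; exact: measurable_funP.
Qed.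

End coverage.

Theorem theorem3p2 (d : measure_display) (T : measurableType d) (R : realType)
    (P : probability T R) (n : nat) (X : {RV P >-> R})
    (Xs : 'I_n -> {RV P >-> R}) (u : R -> R) (alpha q : R) :
  (1 < n)%N ->
  (forall w, 0 < X w) ->
  (forall k w, 0 < Xs k w) ->
  'E_P[X]%E = +oo%E ->
  is_sample X Xs ->
  {within `[0, +oo[%classic, continuous u} ->
  {in `[0, +oo[ &, {homo u : x y /~ x < y}} ->
  {in `[0, +oo[, forall x, 0 <= u x} ->
  ('E_P[fun w => (u (X w) ^+ 2)%R] < +oo)%E ->
  (P [set w | (q%:E < `|studentized u Xs X w|)%E] <= (1 - alpha)%:E)%E ->
  (forall w, uinv_ext u @` `]lower u Xs q w, upper u Xs q w[%classic =
             `]back_lower u Xs q w, back_upper u Xs q w[%classic) /\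
  (P [set w | ~ (back_lower u Xs q w <= (u_mean u X)%:E
                   <= back_upper u Xs q w)%E] <= (1 - alpha)%:E)%E.
Proof.
move=> n1 X0 Xs0 _ _ uc ud u0 _ Pq; split; last exact: noncoverage_le Pq.
by move=> w; exact: back_transform_interval.
Qed.
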